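(* Let $M$ be a matroid of rank $k$ on an $n$-element ground set $E$. Then, as rational functions, \[W_{M}(X,Y,Z)=(X-Y)^{n-k}Y^{k}\,t_{M}\!\left(\frac{X}{Y},\frac{X+(Z-1)Y}{X-Y}\right).\]
   Context: For a matroid $M$ on $E$ with rank function $r$, the nullity is $n_M(\sigma)=|\sigma|-r(\sigma)$. The Tutte polynomial is $t_M(X,Y)=\sum_{\sigma\subseteq E}(X-1)^{r(E)-r(\sigma)}(Y-1)^{|\sigma|-r(\sigma)}$. Generalized weight polynomials: $P_{M,0}(Z)=1$ and, for $1\le j\le n$, $P_{M,j}(Z)=(-1)^j\sum_{|\sigma|=j}\sum_{\gamma\subseteq\sigma}(-1)^{|\gamma|}Z^{n_M(\gamma)}$ (sums over subsets of $E$). The enumerator of $M$ is $W_M(X,Y,Z)=\sum_{i=0}^{n}P_{M,i}(Z)X^{n-i}Y^i$. *)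

(* Defs.v *)
From HB Require Import structures.
From mathcomp Require Import all_boot all_algebra fraction mpoly.
Set Implicit Arguments.
Unset Strict Implicit.
Unset Printing Implicit Defensive.
Import GRing.Theory.
Local Open Scope ring_scope.

Record matroid (E : finType) := Matroid {
  indep : {set {set E}};
  indep0 : set0 \in indep;
  indep_sub (I J : {set E}) : I \subset J -> J \in indep -> I \in indep;
  indep_aug (I J : {set E}) : I \in indep -> J \in indep ->
    (#|I| < #|J|)%N -> exists2 x, x \in J :\: I & x |: I \in indep
}.

Section Matroid.
Variables (E : finType) (M : matroid E).
Implicit Types s g : {set E}.

Definition rank s : nat := \max_(I in indep M | I \subset s) #|I|.

(* Truncated subtraction is harmless here and in [tutte]: rank s <= #|s| and
   rank s <= rank [set: E]. *)
Definition nullity s : nat := (#|s| - rank s)%N.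

(* The variables X, Y are 'X_0, 'X_1. *)
Definition tutte : {mpoly int[2]} :=
  \sum_(s : {set E}) ('X_0 - 1) ^+ (rank [set: E] - rank s)
                   * ('X_1 - 1) ^+ (#|s| - rank s).

(* Only meaningful for j <= #|E|. *)
Definition gwpoly (j : nat) : {poly int} :=
  if j == 0%N then 1 else
  (-1) ^+ j * \sum_(s : {set E} | #|s| == j)
                \sum_(g : {set E} | g \subset s) (-1) ^+ #|g| * 'X^(nullity g).

(* The variables X, Y, Z are 'X_0, 'X_1, 'X_2; the one-variable polynomial
   [gwpoly i] is evaluated at Z. *)
Definition enumerator : {mpoly int[3]} :=
  \sum_(i < #|E|.+1)
    (map_poly intr (gwpoly i)).['X_2] * 'X_0 ^+ (#|E| - i) * 'X_1 ^+ i.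

End Matroid.

Notation ratfun := {fraction {mpoly int[3]}}.
Notation "x %:F" := (FracField.tofrac x) : ring_scope.

Definition ratX : ratfun := ('X_0 : {mpoly int[3]})%:F.
Definition ratY : ratfun := ('X_1 : {mpoly int[3]})%:F.
Definition ratZ : ratfun := ('X_2 : {mpoly int[3]})%:F.

Definition eval2 (R : comNzRingType) (p : {mpoly int[2]}) (a b : R) : R :=
  mmap intr (tnth [tuple a; b]) p.

(* Main.v *)
(** Expanding the product of (y or -y) + (0 or x) over the elements of [E]
    evaluates the sum of [(-1)^(|s|+|g|) x^(n-|s|) y^|s|] over the [s] containing
    [g] to [y^|g| (x - y)^(n-|g|)].  Hence exchanging the sums over [s] and [g]
    turns the enumerator into the sum over [g] of
    [Z^(nullity g) Y^|g| (X - Y)^(n-|g|)], which is also, term by term, the right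
    hand side, as [X/Y - 1 = (X-Y)/Y] and
    [(X+(Z-1)Y)/(X-Y) - 1 = ZY/(X-Y)]. *)
Require Import Defs.
From mathcomp Require Import all_boot all_algebra fraction mpoly.
From mathcomp Require Import ring.
Set Implicit Arguments.
Unset Strict Implicit.
Unset Printing Implicit Defensive.
Import GRing.Theory.
Local Open Scope ring_scope.

Lemma sum_supset_alternating (R : comNzRingType) (E : finType) (g : {set E})
    (x y : R) :
  \sum_(s : {set E} | g \subset s)
     (-1) ^+ (#|s| + #|g|) * x ^+ (#|E| - #|s|) * y ^+ #|s| =
  (x - y) ^+ (#|E| - #|g|) * y ^+ #|g|.
Proof.
have cardN (A : {set E}) : #|[pred i | i \notin A]| = (#|E| - #|A|)%N.
  by rewrite -(cardC A) addKn; apply: eq_card => i; rewrite !inE.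
transitivity (\prod_(i : E) ((if i \in g then y else - y) +
                             (if i \in g then 0 else x))); last first.
  rewrite (bigID (mem g)) /= mulrC; congr (_ * _).
    rewrite (eq_bigr (fun=> x - y)); last by move=> i /negPf->; rewrite addrC.
    by rewrite prodr_const cardN.
  rewrite (eq_bigr (fun=> y)); last by move=> i ->; rewrite addr0.
  by rewrite prodr_const.
(* In the expansion, [s] collects the elements whose first summand is chosen. An element of [g]
   outside [s] contributes the factor 0, so only supersets of [g] survive. *)
rewrite bigA_distr big_mkcond /=; apply: eq_bigr => s _.
case: ifPn => [gs | /subsetPn [i ig iNs]]; last first.
  by rewrite (bigD1 i) //= (negPf iNs) ig mul0r.
rewrite (bigID (mem s)) /= [X in _ = _ * X](eq_bigr (fun=> x)); last first.
  move=> i iNs; rewrite (negPf iNs); case: ifP => // ig.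
  by rewrite (subsetP gs _ ig) in iNs.
rewrite [X in _ = X * _](eq_bigr (fun i => (if i \in g then 1 else -1) * y));
  last by move=> i ->; case: ifP; rewrite ?mul1r ?mulN1r.
rewrite big_split /= prodr_const (bigID (mem g)) /=.
rewrite big1 ?mul1r; last by move=> i /andP[_ ->].
rewrite (eq_bigr (fun=> -1)); last by move=> i /andP[_ /negPf->].
rewrite !prodr_const.
have -> : #|[pred i | (i \in s) && (i \notin g)]| = (#|s| - #|g|)%N.
  by rewrite -[in RHS](setIidPr gs) -cardsD; apply: eq_card => i; rewrite !inE andbC.
(* The exponents [#|s| + #|g|] and [#|s| - #|g|] differ by the even number [2 * #|g|], so the signs
   agree. *)
rewrite cardN -{1}(subnK (subset_leq_card gs)) -addnA addnn exprD -mul2n exprM sqrrN.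
by rewrite !expr1n mulr1 mulrAC.
Qed.

Section Matroid.
Variables (E : finType) (M : matroid E).
Implicit Types s g : {set E}.

Lemma rank_le_card s : (rank M s <= #|s|)%N.
Proof. by apply/bigmax_leqP => I /andP[_ /subset_leq_card]. Qed.

Lemma rank_mono s g : s \subset g -> (rank M s <= rank M g)%N.
Proof.
move=> sg; apply/bigmax_leqP => I /andP[IM Is].
by apply: (leq_bigmax_cond (F := fun I : {set E} => #|I|)); rewrite IM (subset_trans Is).
Qed.

(** The separate value at [j = 0] fits the general formula, since there only [s = g = set0] occurs,
    with nullity 0. Moving the sign inside as a power of [#|s|] gives the shape needed for
    [sum_supset_alternating]. *)
Lemma gwpolyE j : gwpoly M j = \sum_(s : {set E} | #|s| == j)
  \sum_(g : {set E} | g \subset s) (-1) ^+ (#|s| + #|g|) * 'X^(nullity M g).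
Proof.
rewrite /gwpoly; case: eqP => [->|_].
  rewrite (eq_bigl (pred1 set0)); last by move=> s; rewrite cards_eq0.
  rewrite big_pred1_eq (eq_bigl (pred1 set0)); last by move=> g; rewrite subset0.
  by rewrite big_pred1_eq /nullity cards0 sub0n mulr1.
rewrite mulr_sumr; apply: eq_bigr => s /eqP <-.
by rewrite mulr_sumr; apply: eq_bigr => g _; rewrite exprD mulrA.
Qed.

Lemma enumeratorE : enumerator M = \sum_(g : {set E})
  'X_2 ^+ nullity M g * (('X_0 - 'X_1) ^+ (#|E| - #|g|) * 'X_1 ^+ #|g|).
Proof.
rewrite /enumerator.
transitivity (\sum_(s : {set E}) \sum_(g : {set E} | g \subset s)
    'X_2 ^+ nullity M g * ((-1) ^+ (#|s| + #|g|) * 'X_0 ^+ (#|E| - #|s|) *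
      'X_1 ^+ #|s|) : {mpoly int[3]}).
  have cardE s : (#|s| < #|E|.+1)%N by rewrite ltnS max_card.
  (* Group the subsets [s] by cardinality, read as an index of the enumerator. *)
  rewrite [RHS](partition_big (fun s => Ordinal (cardE s)) xpredT) //=.
  apply: eq_bigr => i _; rewrite gwpolyE rmorph_sum horner_sum !mulr_suml.
  apply: eq_big => [s | s /eqP <-]; first by rewrite -val_eqE.
  rewrite rmorph_sum horner_sum !mulr_suml; apply: eq_bigr => g _.
  rewrite rmorphM rmorphXn rmorphN rmorph1 /= map_polyXn hornerM hornerXn.
  by rewrite horner_exp hornerN hornerC [_ * 'X_2 ^+ _]mulrC -!mulrA.
rewrite (exchange_big_dep xpredT) //=; apply: eq_bigr => g _.
by rewrite -mulr_sumr sum_supset_alternating.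
Qed.

Lemma eval2_tutte (R : comNzRingType) (a b : R) :
  eval2 (tutte M) a b = \sum_(s : {set E})
    (a - 1) ^+ (rank M [set: E] - rank M s) * (b - 1) ^+ nullity M s.
Proof.
rewrite /eval2 /tutte rmorph_sum /=; apply: eq_bigr => s _.
by rewrite rmorphM !rmorphXn !rmorphB !rmorph1 /= !mmapX !mmap1U.
Qed.

End Matroid.

(** Here [r] and [m] stand for the rank and size of a subset, [k] and [n] for those of the ground
    set. The exponents of [x - y] add up to [(n - k) + (k - r) - (m - r) = n - m], those of [y] to
    [k - (k - r) + (m - r) = m]. *)
Lemma tutte_term_subst (F : fieldType) (x y z : F) (r k m n : nat) :
  y != 0 -> x - y != 0 -> (r <= k)%N -> (r <= m)%N -> (k <= n)%N -> (m <= n)%N ->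
  (x - y) ^+ (n - k) * y ^+ k *
    ((x / y - 1) ^+ (k - r) * ((x + (z - 1) * y) / (x - y) - 1) ^+ (m - r)) =
  z ^+ (m - r) * ((x - y) ^+ (n - m) * y ^+ m).
Proof.
move=> y0 d0 rk rm kn mn.
have -> : x / y - 1 = (x - y) / y by field.
have -> : (x + (z - 1) * y) / (x - y) - 1 = z * y / (x - y) by field.
move: (x - y) d0 => d d0.
have -> : d ^+ (n - m) * y ^+ m =
    d ^+ (n - k) * d ^+ (k - r) / d ^+ (m - r) * (y ^+ r * y ^+ (m - r)).
  rewrite -!exprD subnKC // addnBA // subnK //.
  have -> : (n - r = (n - m) + (m - r))%N by rewrite addnBA // subnK.
  by rewrite exprD mulfK // expf_neq0.
have -> : y ^+ k = y ^+ (k - r) * y ^+ r by rewrite -exprD subnK.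
rewrite !expr_div_n exprMn.
have := expf_neq0 (m - r) d0; have := expf_neq0 (k - r) y0.
(* The powers in the denominators become atoms known to be nonzero. *)
move: (d ^+ (m - r)) (y ^+ (k - r)) => d' y' y'0 d'0.
by field; rewrite d'0.
Qed.

(** Needed because division by 0 is a default value: the substitution is only meaningful once both
    denominators, [ratY] and [ratX - ratY], are nonzero. *)
Lemma ratY_neq0 : ratY != 0.
Proof.
rewrite tofrac_eq0; apply/eqP => /(congr1 (mcoeff U_(1))).
by rewrite mcoeffX mcoeff0 eqxx.
Qed.

Lemma ratXsubY_neq0 : ratX - ratY != 0.
Proof.
rewrite /ratX /ratY -tofracB tofrac_eq0 subr_eq0.
apply/eqP => /(congr1 (mcoeff U_(0))).
by rewrite !mcoeffX eqxx eq_mnm1 => /eqP.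
Qed.

Theorem theorem3 (E : finType) (M : matroid E) (n k : nat)
    (hn : #|E| = n) (hk : rank M [set: E] = k) :
  (enumerator M)%:F =
  (ratX - ratY) ^+ (n - k) * ratY ^+ k *
  eval2 (tutte M) (ratX / ratY) ((ratX + (ratZ - 1) * ratY) / (ratX - ratY))
  :> ratfun.
Proof.
rewrite enumeratorE eval2_tutte -{}hn -{}hk rmorph_sum mulr_sumr.
apply: eq_bigr => s _ /=.
rewrite !(rmorphM, rmorphXn, rmorphB) /= -/ratX -/ratY -/ratZ.
rewrite tutte_term_subst ?rank_le_card ?rank_mono ?subsetT ?max_card //.
    exact: ratY_neq0.
  exact: ratXsubY_neq0.
by rewrite -cardsT rank_le_card.
Qed.
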